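(* Let $\Theta=\{1,2\}$, let $P_1,\dots,P_m$ be experiments, and let $(A,u)$ be a decision problem with $A=\{a_1,\dots,a_n\}$ satisfying: $u(1,a_1)<\cdots<u(1,a_n)$; $u(2,a_1)>\cdots>u(2,a_n)$; $u(\cdot,a_1)=(0,0)$; and no $a_i$ is weakly*-dominated (there is no $\alpha\in\Delta(A\setminus\{a_i\})$ with $u(\cdot,a_i)\le u(\cdot,\alpha)$ componentwise). Let $(A_1^*,u_1^* ),\dots,(A_{n-1}^*,u_{n-1}^* )$ be the canonical decomposition of $(A,u)$ and, for each $\ell$, let $\sigma_\ell^*:\mathbf Y\to\Delta(A_\ell^* )$ be robustly optimal for $(A_\ell^*,u_\ell^* )$. Then: (1) $V(P_1,\dots,P_m;(A,u))=\sum_{\ell=1}^{n-1}\max_{j=1,\dots,m}V(P_j;(A_\ell^*,u_\ell^* ))$; (2) there exists $\sigma^*:\mathbf Y\to\Delta(A)$ with $u(\sigma^*(\mathbf y))\ge\sum_{\ell=1}^{n-1}u_\ell^*(\sigma_\ell^*(\mathbf y))$ for all $\mathbf y\in\mathbf Y$, and every such $\sigma^*$ is robustly optimal for $(A,u)$.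
   Context: $\Theta$ is a finite set of states. A decision problem is a pair $(A,u)$ with $A$ a finite nonempty action set and $u:\Theta\times A\to\mathbb{R}$; for $\alpha\in\Delta(A)$ write $u(\theta,\alpha)=\sum_a\alpha(a)u(\theta,a)$ and $u(\alpha)=(u(\theta,\alpha))_{\theta}$; vector inequalities are componentwise. An experiment is a map $P:\Theta\to\Delta(Y)$ with $Y$ a finite signal set. Given experiments $P_j:\Theta\to\Delta(Y_j)$, $j=1,\dots,m$, let $\mathbf Y=Y_1\times\cdots\times Y_m$ and let $\mathcal P(P_1,\dots,P_m)$ be the set of experiments $P:\Theta\to\Delta(\mathbf Y)$ whose $j$-th marginal is $P_j(\cdot|\theta)$ for every $\theta$ and $j$. A strategy is a map $\sigma:\mathbf Y\to\Delta(A)$. Define $V(P_1,\dots,P_m;(A,u))=\max_{\sigma}\min_{P\in\mathcal P(P_1,\dots,P_m)}\sum_{\theta}\sum_{\mathbf y}P(\mathbf y|\theta)u(\theta,\sigma(\mathbf y))$, and call a maximizing $\sigma$ robustly optimal for $(A,u)$; for $m=1$, $V(P;(A,u))=\max_{\sigma:Y\to\Delta(A)}\sum_\theta\sum_y P(y|\theta)u(\theta,\sigma(y))$. For $(A,u)$ with actions ordered $a_1,\dots,a_n$ as in the claim, its canonical decomposition is the collection of $n-1$ binary-action problems $(A_\ell^*,u_\ell^* )$, $\ell=1,\dots,n-1$, with $A_\ell^*=\{0,1\}$, $u_\ell^*(\cdot,0)=(0,0)$ and $u_\ell^*(\cdot,1)=u(\cdot,a_{\ell+1})-u(\cdot,a_\ell)$.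 *)

(* Defs.v *)
From HB Require Import structures.
From mathcomp Require Import all_boot all_order all_algebra.
From mathcomp Require Import boolp classical_sets reals.
Set Implicit Arguments. Unset Strict Implicit. Unset Printing Implicit Defensive.
Import Order.TTheory GRing.Theory Num.Theory.
Local Open Scope ring_scope.
Local Open Scope classical_set_scope.

Definition Theta : finType := 'I_2.
Definition state1 : Theta := ord0.
Definition state2 : Theta := ord_max.

Definition isDist (R : numDomainType) (X : finType) (p : X -> R) : Prop :=
  (forall x, 0 <= p x) /\ \sum_(x : X) p x = 1.

Definition eu (R : numDomainType) (A : finType) (u : Theta -> A -> R)
  (th : Theta) (alpha : A -> R) : R := \sum_(a : A) alpha a * u th a.

Definition isExperiment (R : numDomainType) (Y : finType) (P : Theta -> Y -> R) : Prop :=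
  forall th, isDist (P th).

Definition jointY (m : nat) (Y : 'I_m -> finType) : finType :=
  {dffun forall j : 'I_m, Y j}.

Definition isCoupling (R : numDomainType) (m : nat) (Y : 'I_m -> finType)
  (P : forall j : 'I_m, Theta -> Y j -> R) (Q : Theta -> jointY Y -> R) : Prop :=
  (forall th, isDist (Q th)) /\
  (forall th (j : 'I_m) (y : Y j),
      \sum_(yy : jointY Y | yy j == y) Q th yy = P j th y).

Definition isStrategy (R : numDomainType) (Yb A : finType) (sigma : Yb -> A -> R) : Prop :=
  forall y, isDist (sigma y).

Definition payoff (R : numDomainType) (Yb A : finType) (u : Theta -> A -> R)
  (Q : Theta -> Yb -> R) (sigma : Yb -> A -> R) : R :=
  \sum_(th : Theta) \sum_(y : Yb) Q th y * eu u th (sigma y).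

Definition worst (R : realType) (m : nat) (Y : 'I_m -> finType) (A : finType)
  (P : forall j : 'I_m, Theta -> Y j -> R) (u : Theta -> A -> R)
  (sigma : jointY Y -> A -> R) : R :=
  inf [set r : R | exists Q, isCoupling P Q /\ r = payoff u Q sigma].

Definition Vrob (R : realType) (m : nat) (Y : 'I_m -> finType) (A : finType)
  (P : forall j : 'I_m, Theta -> Y j -> R) (u : Theta -> A -> R) : R :=
  sup [set r : R | exists sigma : jointY Y -> A -> R,
                     isStrategy sigma /\ r = worst P u sigma].

Definition robustly_optimal (R : realType) (m : nat) (Y : 'I_m -> finType) (A : finType)
  (P : forall j : 'I_m, Theta -> Y j -> R) (u : Theta -> A -> R)
  (sigma : jointY Y -> A -> R) : Prop :=
  isStrategy sigma /\ worst P u sigma = Vrob P u.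

Definition Vsingle (R : realType) (Y A : finType) (P : Theta -> Y -> R)
  (u : Theta -> A -> R) : R :=
  sup [set r : R | exists sigma : Y -> A -> R, isStrategy sigma /\ r = payoff u P sigma].

(* Canonical decomposition of (A,u) with A = {a_1,...,a_{n+1}} = 'I_n.+1
   (a_k is the ordinal k-1).  For l : 'I_n (paper's index l+1), the binary
   problem has actions bool (false = 0, true = 1),
   u*(.,0) = 0 and u*(.,1) = u(., a_{l+2}) - u(., a_{l+1}) (paper indexing). *)
Definition canon_u (R : numDomainType) (n : nat) (u : Theta -> 'I_n.+1 -> R)
  (l : 'I_n) : Theta -> bool -> R :=
  fun th b => if b then u th (lift ord0 l) - u th (widen_ord (leqnSn n) l) else 0.

(* Main.v *)
Require Import Defs.
From HB Require Import structures.
From mathcomp Require Import all_boot all_order all_algebra.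
From mathcomp Require Import boolp classical_sets reals.
From mathcomp Require Import ring lra zify.
Import Order.TTheory GRing.Theory Num.Theory.
Local Open Scope ring_scope.
Set Implicit Arguments.
Unset Strict Implicit.
Unset Printing Implicit Defensive.

(** With two states an experiment amounts to a finite measure of posteriors on [0, 1], and its
    value in a binary problem is, up to constants, the potential [t |-> sum w |x - t|] of that
    measure at the indifference posterior of the problem. Undominatedness makes these cutoffs
    strictly increasing along the canonical decomposition, so the maximum over [j] of the
    potentials of the [P_j], interpolated linearly at the cutoffs, is the potential of a measure
    dominating every [P_j] in the convex order, hence (Strassen, i.e. Blackwell) every [P_j] is a
    garbling of it. Garbling independently for each [j] gives a coupling under which no strategy
    earns more than the sum of the binary values. Conversely, robustly optimal strategies of the
    binary problems guarantee the sum of the binary values, and their combined payoff vector is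
    dominated by a mixture of two consecutive actions. *)

(** * Sums against indicators and over dependent products *)

Lemma sum_delta (R : pzRingType) (T : finType) (a : T) (f : T -> R) :
  \sum_z (z == a)%:R * f z = f a.
Proof.
rewrite (bigD1 a) //= eqxx mul1r big1 ?addr0 // => z /negbTE ->; exact: mul0r.
Qed.

Lemma sum_prod_dffun (R : comPzRingType) (I : finType) (T : I -> finType)
    (F : forall i, T i -> R) :
  \sum_(f : {dffun forall i, T i}) \prod_i F i (f i) = \prod_i \sum_(x : T i) F i x.
Proof.
rewrite (reindex (@dffun_of_fprod _ T)); last exact/onW_bij/dffun_of_fprod_bij.
transitivity (\sum_(t : fprod T) \prod_(i in I) [ffun x => F i x] (t i)).
  by apply: eq_bigr => t _; apply: eq_bigr => i _; rewrite !ffunE.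
rewrite big_fprod -(bigA_distr_big_dep _ (fun i u => untag 0 [ffun x => F i x] u)).
apply: eq_bigr => i _.
rewrite -(big_tag (fun i x => [ffun x => F i x] x)).
by apply: eq_bigr => x _; rewrite ffunE.
Qed.

Lemma sum_prod_dffun_marginal (R : comPzRingType) (I : finType) (T : I -> finType)
    (F : forall i, T i -> R) (j : I) (y : T j) :
  (forall i, i != j -> \sum_(x : T i) F i x = 1) ->
  \sum_(f : {dffun forall i, T i} | f j == y) \prod_i F i (f i) = F j y.
Proof.
move=> F1.
(* The constraint [f j == y] becomes an indicator inside factor [j], so the unconstrained product
   formula applies. Comparing [x] with [y] needs a transport along [i = j], which [eq_axiomK] erases
   at [i = j]. *)
pose G i (x : T i) := F i x *
  (if i =P j is ReflectT e then (ecast k (T k) e x == y)%:R else 1).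
transitivity (\sum_(f : {dffun forall i, T i}) \prod_i G i (f i)).
  rewrite big_mkcond; apply: eq_bigr => f _; rewrite big_split /=.
  rewrite [X in _ = _ * X](bigD1 j) //= [X in _ = _ * (_ * X)]big1 ?mulr1; last first.
    by move=> i; case: eqP.
  case: eqP => // e; rewrite (eq_axiomK e) /=.
  by case: eqP; rewrite ?mulr1 ?mulr0.
rewrite sum_prod_dffun (bigD1 j) //= [X in _ * X]big1 ?mulr1; last first.
  move=> i ij; rewrite -[RHS](F1 i ij); apply: eq_bigr => x _.
  by rewrite /G; case: eqP ij => // _ _; rewrite mulr1.
rewrite (bigD1 y) //= big1 ?addr0 /G; last first.
  move=> x xy; case: eqP => // e; rewrite (eq_axiomK e) /=.
  by rewrite (negbTE xy) mulr0.
by case: eqP => // e; rewrite (eq_axiomK e) /= eqxx mulr1.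
Qed.

(** * Convex order on the line *)

Section Potential.
Variable R : realFieldType.

Definition pot (Z : finType) (w x : Z -> R) (t : R) : R :=
  \sum_z w z * `|x z - t|.

Lemma pot_convex (Z : finType) (w x : Z -> R) (a t b : R) :
  (forall z, 0 <= w z) -> a <= t <= b ->
  (b - a) * pot w x t <= (b - t) * pot w x a + (t - a) * pot w x b.
Proof.
move=> w0 /andP[at_ tb]; rewrite /pot !mulr_sumr -big_split /=.
apply: ler_sum => z _; have {w0}w0 := w0 z.
rewrite !(mulrCA _ (w z)) -mulrDr; apply: ler_wpM2l => //.
rewrite -[b - a]ger0_norm; last by lra.
rewrite -[X in X * `|x z - a|]ger0_norm; last by lra.
rewrite -[X in X * `|x z - b|]ger0_norm; last by lra.
rewrite -!normrM; apply: le_trans (ler_normD _ _).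
by rewrite le_eqVlt; apply/orP; left; apply/eqP; congr `|_|; ring.
Qed.

Lemma pot_affine (Z : finType) (w x : Z -> R) (a t b : R) :
  (forall z, w z != 0 -> x z <= a \/ b <= x z) -> a <= t <= b ->
  (b - a) * pot w x t = (b - t) * pot w x a + (t - a) * pot w x b.
Proof.
move=> gap /andP[at_ tb]; rewrite /pot !mulr_sumr -big_split /=.
apply: eq_bigr => z _; have [->|/gap] := eqVneq (w z) 0; first by rewrite !mul0r !mulr0 addr0.
case=> h.
  by rewrite !ler0_norm; [ring|lra..].
by rewrite !ger0_norm; [ring|lra..].
Qed.

(** A convex function lying below an affine one at both ends of an interval stays below it inside.
    The hypothesis on [w] leaves no atom in the open interval, which makes its potential affine
    there. *)
Lemma pot_le_between (Z Y : finType) (w x : Z -> R) (v y : Y -> R) (a t b : R) :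
  (forall i, 0 <= v i) -> (forall z, w z != 0 -> x z <= a \/ b <= x z) ->
  a <= t <= b -> pot v y a <= pot w x a -> pot v y b <= pot w x b ->
  pot v y t <= pot w x t.
Proof.
move=> v0 gap atb ha hb; have [ab|ba] := ltP a b; last first.
  by have -> : t = a by lra.
have := pot_convex y v0 atb; have := pot_affine gap atb => e1 e2.
rewrite -(ler_pM2l (_ : 0 < b - a)) ?subr_gt0 // e1; apply: le_trans e2 _.
case/andP: atb => ? ?.
by apply: lerD; apply: ler_wpM2l => //; rewrite subr_ge0.
Qed.

(** The convex order of finite measures: given equal mass and mean, testing the functions [|. - t|]
    amounts to testing all convex functions. *)
Definition cx_le (Y Z : finType) (v y : Y -> R) (w x : Z -> R) : Prop :=
  [/\ \sum_i v i = \sum_z w z, \sum_i v i * y i = \sum_z w z * x z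
    & forall t, pot v y t <= pot w x t].

(* Splitting mass of an atom [y i0] between two neighbouring atoms of [w] keeps the order:
   the potentials change by the same amount outside the gap, and inside it the potential
   of [w] is affine while that of [v] is convex. *)
Lemma cx_le_transfer (Y Z : finType) (v y : Y -> R) (w x : Z -> R)
    (a b : Z) (i0 : Y) (al be : R) :
  let w' z := w z - (z == a)%:R * al - (z == b)%:R * be in
  let v' i := v i - (i == i0)%:R * (al + be) in
  cx_le v y w x -> (forall z, 0 <= w' z) -> (forall i, 0 <= v' i) ->
  0 <= al -> 0 <= be ->
  al * x a + be * x b = (al + be) * y i0 ->
  x a <= y i0 <= x b ->
  (forall z, w z != 0 -> x z <= x a \/ x b <= x z) ->
  w a != 0 -> w b != 0 ->
  cx_le v' y w' x.
Proof.
move=> w' v' [mass mean dom] w'0 v'0 al0 be0 bary ayb gap wa wb.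
have sumw' (f : Z -> R) : \sum_z w' z * f z = \sum_z w z * f z - al * f a - be * f b.
  rewrite -(sum_delta a (fun z => al * f z)) -(sum_delta b (fun z => be * f z)).
  by rewrite -!sumrB; apply: eq_bigr => z _; rewrite /w'; ring.
have sumv' (f : Y -> R) : \sum_i v' i * f i = \sum_i v i * f i - (al + be) * f i0.
  rewrite -(sum_delta i0 (fun z => (al + be) * f z)).
  by rewrite -!sumrB; apply: eq_bigr => z _; rewrite /v'; ring.
have far t : t <= x a \/ x b <= t -> pot v' y t <= pot w' x t.
  move=> ht; rewrite /pot sumw' sumv'; move: (dom t); rewrite /pot => dt.
  suff -> : (al + be) * `|y i0 - t| = al * `|x a - t| + be * `|x b - t| by lra.
  case: ht => ht.
    by rewrite !ger0_norm; [lra..].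
  by rewrite !ler0_norm; [lra..].
split.
- have mul1 (T : finType) (f : T -> R) : \sum_t f t = \sum_t f t * 1.
    by apply: eq_bigr => t _; rewrite mulr1.
  by rewrite mul1 sumv' -mul1 mass [RHS]mul1 sumw' -mul1; ring.
- by rewrite sumw' sumv' mean; lra.
- move=> t; have [?|ta] := leP t (x a); first by apply: far; left.
  have [?|tb] := leP (x b) t; first by apply: far; right.
  apply: (@pot_le_between _ _ w' x v' y (x a) t (x b)) => //.
  + move=> z; rewrite /w'; have [->|_] := eqVneq z a; first by left.
    have [->|_] := eqVneq z b; first by right.
    by rewrite !mul0r !subr0; exact: gap.
  + by rewrite !ltW.
  + by apply: far; left.
  + by apply: far; right.
Qed.

(** If every atom of [w] lay to the right of [y i0], then at the leftmost of them, [c], the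
    potential of [w] would be its mean minus its mass times [x c]; that of [v] is strictly larger
    because of the atom [y i0]. The other side is symmetric, and the nearest atoms on each side
    leave a gap between them. *)
Lemma cx_le_atoms_around (Y Z : finType) (v y : Y -> R) (w x : Z -> R) (i0 : Y) :
  cx_le v y w x -> (forall z, 0 <= w z) -> (forall i, 0 <= v i) -> 0 < v i0 ->
  exists a b : Z, [/\ 0 < w a, 0 < w b, x a <= y i0 <= x b
    & forall z, w z != 0 -> x z <= x a \/ x b <= x z].
Proof.
move=> [mass mean dom] w0 v0 vi0.
have wP z : w z != 0 -> 0 < w z by move=> h; rewrite lt0r h w0.
have Vpos : 0 < \sum_i v i.
  by rewrite (bigD1 i0) //= ltr_pwDl // sumr_ge0.
have [z0 wz0] : exists z, w z != 0.
  apply/existsP; apply: contraTT Vpos; rewrite negb_exists => /forallP h.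
  by rewrite mass big1 ?ltxx // => z _; apply/eqP; rewrite -[_ == _]negbK.
have [a0 wa0 xa0] : exists2 z, w z != 0 & x z <= y i0.
  apply/exists_inP; apply: contraT; rewrite negb_exists_in => /forall_inP h.
  case: (arg_minP (P := [pred z | w z != 0]) x wz0) => /= c wc cmin.
  have yc : y i0 < x c by rewrite ltNge h.
  have := dom (x c); rewrite /pot.
  rewrite [X in _ <= X](eq_bigr (fun z => w z * x z - w z * x c)); last first.
    move=> z _; have [->|/cmin hz] := eqVneq (w z) 0; first by rewrite !mul0r subr0.
    by rewrite ger0_norm ?subr_ge0 // mulrBr.
  rewrite sumrB -mean -mulr_suml -mass mulr_suml -sumrB leNgt => /negP[].
  rewrite (bigD1 i0) //= [ltRHS](bigD1 i0) //=; apply: ltr_leD.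
    by rewrite -mulrBr ltr_pM2l // ltr0_norm; lra.
  by apply: ler_sum => i _; rewrite -mulrBr ler_wpM2l // ler_norm.
have [b0 wb0 xb0] : exists2 z, w z != 0 & y i0 <= x z.
  apply/exists_inP; apply: contraT; rewrite negb_exists_in => /forall_inP h.
  case: (arg_maxP (P := [pred z | w z != 0]) x wz0) => /= c wc cmax.
  have yc : x c < y i0 by rewrite ltNge h.
  have := dom (x c); rewrite /pot.
  rewrite [X in _ <= X](eq_bigr (fun z => w z * x c - w z * x z)); last first.
    move=> z _; have [->|/cmax hz] := eqVneq (w z) 0; first by rewrite !mul0r subr0.
    by rewrite distrC ger0_norm ?subr_ge0 // mulrBr.
  rewrite sumrB -mean -mulr_suml -mass mulr_suml -sumrB leNgt => /negP[].
  rewrite (bigD1 i0) //= [ltRHS](bigD1 i0) //=; apply: ltr_leD.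
    by rewrite -mulrBr ltr_pM2l // gtr0_norm; lra.
  by apply: ler_sum => i _; rewrite -mulrBr ler_wpM2l // distrC ler_norm.
have Pa : [pred z | (w z != 0) && (x z <= y i0)] a0 by rewrite /= wa0.
have Pb : [pred z | (w z != 0) && (y i0 <= x z)] b0 by rewrite /= wb0.
case: (arg_maxP x Pa) => a /= /andP[wa xa] amax.
case: (arg_minP x Pb) => b /= /andP[wb xb] bmin.
exists a, b; split; [exact: wP|exact: wP|by rewrite xa|].
move=> z wz; have [h|h] := leP (x z) (y i0).
  by left; apply: amax; rewrite wz.
by right; apply: bmin; rewrite wz ltW.
Qed.

(** Conditionally on [i] the point [x z] has mean [y i]; conditionally on [z] the plan is a
    garbling. *)
Definition martingale_plan (Y Z : finType) (v y : Y -> R) (w x : Z -> R)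
    (k : Z -> Y -> R) : Prop :=
  [/\ forall z i, 0 <= k z i, forall z, \sum_i k z i = w z,
    forall i, \sum_z k z i = v i & forall i, \sum_z k z i * x z = v i * y i].

Definition supp (T : finType) (f : T -> R) : {set T} := [set t | f t != 0].

(* Each transfer exhausts [w a], [w b] or [v i0], so the supports shrink. *)
Lemma strassen (Y Z : finType) (v y : Y -> R) (w x : Z -> R) :
  (forall z, 0 <= w z) -> (forall i, 0 <= v i) -> cx_le v y w x ->
  exists k, martingale_plan v y w x k.
Proof.
have [N] := ubnP (#|supp w| + #|supp v|)%N.
elim: N => // N IH in v w *; rewrite ltnS => leN w0 v0 dom.
have [/existsP[i0 vi0]|] := boolP [exists i, v i != 0]; last first.
  rewrite negb_exists => /forallP hv.
  have hv0 i : v i = 0 by apply/eqP; rewrite -[_ == _]negbK.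
  have hw0 z : w z = 0.
    case: dom => mass _ _; have : \sum_z w z = 0 by rewrite -mass big1.
    by move/eqP; rewrite psumr_eq0 // => /allP/(_ z (mem_index_enum _))/eqP.
  exists (fun _ _ => 0); split => // [z|i|i].
  - by rewrite hw0 big1.
  - by rewrite hv0 big1.
  - by rewrite hv0 mul0r big1 // => z _; rewrite mul0r.
have {}vi0 : 0 < v i0 by rewrite lt0r vi0 v0.
(* One transfer to [i0] followed by the induction hypothesis; [vanish] says that some atom is
   exhausted. *)
have move_mass (a b : Z) (al be : R) :
    let w' z := w z - (z == a)%:R * al - (z == b)%:R * be in
    let v' i := v i - (i == i0)%:R * (al + be) in
    0 < w a -> 0 < w b -> 0 <= al -> 0 <= be ->
    0 <= w' a -> 0 <= w' b -> 0 <= v' i0 ->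
    [|| w' a == 0, w' b == 0 | v' i0 == 0] ->
    al * x a + be * x b = (al + be) * y i0 ->
    x a <= y i0 <= x b ->
    (forall z, w z != 0 -> x z <= x a \/ x b <= x z) ->
    exists k, martingale_plan v y w x k.
  move=> w' v' wa wb al0 be0 w'a w'b v'i0 vanish bary ayb gap.
  have w'0 z : 0 <= w' z.
    have [->//|za] := eqVneq z a; have [->//|zb] := eqVneq z b.
    by rewrite /w' (negbTE za) (negbTE zb) !mul0r !subr0.
  have v'0 i : 0 <= v' i.
    have [->//|ne] := eqVneq i i0.
    by rewrite /v' (negbTE ne) mul0r subr0.
  have dom' := cx_le_transfer dom w'0 v'0 al0 be0 bary ayb gap
    (lt0r_neq0 wa) (lt0r_neq0 wb).
  have sw : supp w' \subset supp w.
    apply/fintype.subsetP => z; rewrite !inE; apply: contraNN => /eqP wz.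
    have za : z != a by apply: contraTneq wa => <-; rewrite wz ltxx.
    have zb : z != b by apply: contraTneq wb => <-; rewrite wz ltxx.
    by rewrite /w' (negbTE za) (negbTE zb) !mul0r !subr0 wz.
  have sv : supp v' \subset supp v.
    apply/fintype.subsetP => i; rewrite !inE; apply: contraNN => /eqP vz.
    have ne : i != i0 by apply: contraTneq vi0 => <-; rewrite vz ltxx.
    by rewrite /v' (negbTE ne) mul0r subr0 vz.
  have lt_supp : (#|supp w'| + #|supp v'| < #|supp w| + #|supp v|)%N.
    case/or3P: vanish => h.
    - rewrite -addSn leq_add ?subset_leq_card // proper_card // properE sw /=.
      by apply/fintype.subsetPn; exists a; rewrite !inE ?negbK ?lt0r_neq0.
    - rewrite -addSn leq_add ?subset_leq_card // proper_card // properE sw /=.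
      by apply/fintype.subsetPn; exists b; rewrite !inE ?negbK ?lt0r_neq0.
    - rewrite -addnS leq_add ?subset_leq_card // proper_card // properE sv /=.
      by apply/fintype.subsetPn; exists i0; rewrite !inE ?negbK ?lt0r_neq0.
  have [k [k0 kw kv kx]] := IH v' w' (leq_trans lt_supp leN) w'0 v'0 dom'.
  exists (fun z i => k z i + (i == i0)%:R * ((z == a)%:R * al + (z == b)%:R * be)).
  split.
  - by move=> z i; rewrite addr_ge0 // mulr_ge0 ?ler0n // addr_ge0 // mulr_ge0 ?ler0n.
  - by move=> z; rewrite big_split /= kw sum_delta /w'; ring.
  - move=> i; rewrite big_split /= kv -mulr_sumr big_split /=.
    by rewrite (sum_delta a (fun=> al)) (sum_delta b (fun=> be)) /v'; ring.
  - move=> i; under eq_bigr do rewrite mulrDl -mulrA mulrDl -!mulrA.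
    rewrite big_split /= kx -mulr_sumr big_split /=.
    rewrite (sum_delta a (fun z => al * x z)) (sum_delta b (fun z => be * x z)).
    rewrite bary /v'; have [->|_] := eqVneq i i0; rewrite ?eqxx ?mul0r ?mul1r; ring.
have [a [b [wa wb /andP[xa xb] gap]]] := cx_le_atoms_around dom w0 v0 vi0.
(* An atom sitting exactly at [y i0] is the degenerate transfer with [a = b = c] and [be = 0]; the
   gap condition is then just totality of the order. *)
have at_point c : 0 < w c -> x c = y i0 ->
    exists k, martingale_plan v y w x k.
  move=> wc xc; apply: (move_mass c c (Num.min (w c) (v i0)) 0) => //;
    rewrite ?eqxx ?mulr0 ?subr0 ?mul1r ?addr0 ?subr_ge0 ?subr_eq0
      ?ge_min ?lexx ?orbT ?xc //.
  - by rewrite le_min !ltW.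
  - by rewrite minElt; case: ifP; rewrite eqxx ?orbT.
  - by rewrite ?mul0r ?addr0.
  - by rewrite lexx.
  - by move=> z _; apply/orP; exact: le_total.
have [xa'|xa'] := eqVneq (x a) (y i0); first exact: (at_point a).
have [xb'|xb'] := eqVneq (x b) (y i0); first exact: (at_point b).
have {xa xa'}xa : x a < y i0 by rewrite lt_neqAle xa'.
have {xb xb'}xb : y i0 < x b by rewrite lt_neqAle eq_sym xb'.
have ab : a != b by apply: contraTneq (lt_trans xa xb) => ->; rewrite ltxx.
(* Barycentric weights of [y i0] between [x a] and [x b]. *)
set p := (x b - y i0) / (x b - x a); set q := (y i0 - x a) / (x b - x a).
have p0 : 0 < p by rewrite divr_gt0 // subr_gt0 // (lt_trans xa).
have q0 : 0 < q by rewrite divr_gt0 // subr_gt0 // (lt_trans xa).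
have pq : p + q = 1 by rewrite /p /q; field; lra.
have pqx : p * x a + q * x b = y i0 by rewrite /p /q; field; lra.
(* The largest mass that can be moved in the proportions [p] and [q]; whichever term attains the
   minimum names the exhausted atom. *)
set e := Num.min (v i0) (Num.min (w a / p) (w b / q)).
have e0 : 0 <= e.
  by rewrite !le_min (ltW vi0) (divr_ge0 (ltW wa) (ltW p0)) (divr_ge0 (ltW wb) (ltW q0)).
have ev : e <= v i0 by rewrite ge_min lexx.
have ea : e * p <= w a by rewrite -ler_pdivlMr // !ge_min lexx orbT.
have eb : e * q <= w b by rewrite -ler_pdivlMr // !ge_min lexx !orbT.
apply: (move_mass a b (e * p) (e * q)) => //.
- by rewrite mulr_ge0 // ltW.
- by rewrite mulr_ge0 // ltW.
- by rewrite eqxx (negbTE ab) mul1r mul0r subr0 subr_ge0.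
- by rewrite eq_sym eqxx (negbTE ab) mul1r mul0r subr0 subr_ge0.
- by rewrite eqxx mul1r -mulrDr pq mulr1 subr_ge0.
- rewrite !eqxx (eq_sym b) (negbTE ab) !mul1r !mul0r !subr0 -mulrDr pq mulr1 !subr_eq0.
  have [h|[h|h]] : e = v i0 \/ e = w a / p \/ e = w b / q.
    rewrite /e; case: leP => _; first by left.
    by right; case: leP => _; [left|right].
  + by rewrite h eqxx !orbT.
  + by rewrite h divfK ?eqxx ?lt0r_neq0.
  + by rewrite h divfK ?eqxx ?orbT ?lt0r_neq0.
- by rewrite -(mulrDr e p q) pq mulr1 -pqx; ring.
- by rewrite !ltW.
Qed.
End Potential.

(** * Upper bounds in the convex order *)

Section Sup.
Variable R : realFieldType.

Lemma increasing_upto_le (N : nat) (t : nat -> R) :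
  (forall i, (i < N)%N -> t i < t i.+1) ->
  forall i j, (i <= j <= N)%N -> t i <= t j.
Proof.
move=> tS i; elim=> [|j IH] /andP[ij jN]; first by case: i ij.
move: ij; rewrite leq_eqVlt => /orP[/eqP->//|ij].
apply: le_trans (IH _) (ltW (tS _ jN)); lia.
Qed.

Lemma sum_by_parts (N : nat) (S f : nat -> R) :
  \sum_(i < N.+1) (S i.+1 - S i) * f i =
  S N.+1 * f N - S 0%N * f 0%N - \sum_(i < N) S i.+1 * (f i.+1 - f i).
Proof.
elim: N => [|N IH]; first by rewrite big_ord_recr !big_ord0 /=; ring.
by rewrite big_ord_recr IH [in RHS]big_ord_recr /=; ring.
Qed.

(** The slope of a potential jumps at each atom by twice its weight, so the weights are half the
    slope jumps of the piecewise linear interpolation of [g], continued with slopes [- W] and [W]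
    outside. Convexity of [g] makes the inner weights nonnegative, the two Lipschitz bounds the
    outer ones, and the condition on [g 0%N + g N] fixes the additive constant. *)
Lemma interpolating_measure (M : nat) (t g : nat -> R) (W : R) :
  let N := M.+1 in
  (forall i, (i < N)%N -> t i < t i.+1) ->
  (forall i, (i.+1 < N)%N ->
     (g i.+1 - g i) * (t i.+2 - t i.+1) <= (g i.+2 - g i.+1) * (t i.+1 - t i)) ->
  g 0%N - g 1%N <= W * (t 1%N - t 0%N) -> g N - g M <= W * (t N - t M) ->
  g 0%N + g N = W * (t N - t 0%N) ->
  exists w : 'I_N.+1 -> R, [/\ forall i, 0 <= w i, \sum_i w i = W,
    2 * \sum_i w i * t i = W * (t N + t 0%N) - (g N - g 0%N)
    & forall k : 'I_N.+1, pot w (fun i => t i) (t k) = g k].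
Proof.
move=> N tS cvx lip0 lipN ends.
have dt i : (i < N)%N -> 0 < t i.+1 - t i by move=> /tS; rewrite subr_gt0.
have t_le := increasing_upto_le tS.
pose s i := (g i.+1 - g i) / (t i.+1 - t i).
have sK i : (i < N)%N -> s i * (t i.+1 - t i) = g i.+1 - g i.
  by move=> /dt h; rewrite divfK ?lt0r_neq0.
(* [S i] is the slope just to the left of node [i]; at [N.+1] it is the slope beyond the last
   node. *)
pose S i := if i is i'.+1 then if (i' < N)%N then s i' else W else - W.
pose w (i : 'I_N.+1) := (S i.+1 - S i) / 2.
(* Summation by parts, to be used with [f] constant, the identity on nodes, and the distance to
   [t k]. *)
have abel (f : nat -> R) : 2 * (\sum_i w i * f i) =
    W * f N + W * f 0%N - \sum_(i < N) s i * (f i.+1 - f i).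
  rewrite mulr_sumr; transitivity (\sum_(i < N.+1) (S i.+1 - S i) * f i).
    by apply: eq_bigr => i _; rewrite /w; field.
  rewrite sum_by_parts /= ltnn mulNr opprK; congr (_ - _).
  by apply: eq_bigr => i _; rewrite ltn_ord.
exists w; split.
- move=> [i iN]; rewrite /w /= divr_ge0 // subr_ge0.
  case: i iN => [|i] iN /=; first by rewrite /s ler_pdivlMr ?dt // mulNr; lra.
  rewrite ltnS in iN; rewrite iN; case: ifP => iN'.
    rewrite /s ler_pdivrMr ?dt // mulrAC ler_pdivlMr ?dt //; exact: cvx.
  have -> : i = M by move: iN iN'; rewrite /N; lia.
  by rewrite /s ler_pdivrMr ?dt.
- apply: (mulfI (_ : 2 != 0 :> R)); first by rewrite pnatr_eq0.
  transitivity (2 * \sum_i w i * 1); first by congr (_ * _); apply: eq_bigr => i _; rewrite mulr1.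
  rewrite (abel (fun=> 1)) big1 => [|i _]; last by rewrite subrr mulr0.
  ring.
- rewrite abel; have -> : \sum_(i < N) s i * (t i.+1 - t i) = g N - g 0%N.
    rewrite (eq_bigr (fun i : 'I_N => g i.+1 - g i)); last by move=> i _; rewrite sK.
    by rewrite -(big_mkord predT (fun i => g i.+1 - g i)) telescope_sumr.
  ring.
- move=> k; apply: (mulfI (_ : 2 != 0 :> R)); first by rewrite pnatr_eq0.
  rewrite /pot (abel (fun i => `|t i - t k|)).
  have kN : (k <= N)%N by rewrite -ltnS.
  rewrite ger0_norm ?subr_ge0 ?t_le ?kN ?leqnn // ler0_norm ?subr_le0 ?t_le //.
  suff -> : \sum_(i < N) s i * (`|t i.+1 - t k| - `|t i - t k|) = g N + g 0%N - 2 * g k.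
    move: ends; lra.
  (* The distance to [t k] decreases up to node [k] and increases afterwards, so the sum telescopes
     in two pieces of opposite sign meeting at [g k]. *)
  rewrite (eq_bigr (fun i : 'I_N => (if (i < k)%N then -1 else 1) * (g i.+1 - g i))); last first.
    move=> i _; rewrite -sK //; case: ltnP => ik.
      rewrite !ler0_norm ?subr_le0 ?t_le ?ik //; first by ring.
      by rewrite ltnW.
    rewrite !ger0_norm ?subr_ge0 ?t_le ?ik ?ltn_ord //; first by ring.
      by rewrite ltnW.
    by rewrite leqW // ltn_ord.
  have tel n : \sum_(i < n) (if (i < k)%N then -1 else 1) * (g i.+1 - g i) =
      if (n <= k)%N then g 0%N - g n else g n + g 0%N - 2 * g k.
    elim: n => [|n IH]; first by rewrite big_ord0 subrr.
    rewrite big_ord_recr /= IH; case: (ltngtP n k) => nk; [ring|ring|].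
    by rewrite nk; ring.
  rewrite tel; case: leqP => // Nk; have -> : nat_of_ord k = N by lia.
  ring.
Qed.

Lemma pot_lip (Y : finType) (v y : Y -> R) (a b : R) : (forall i, 0 <= v i) ->
  pot v y a <= pot v y b + (\sum_i v i) * `|b - a|.
Proof.
move=> v0; rewrite /pot mulr_suml -big_split /=; apply: ler_sum => i _.
rewrite -mulrDr ler_wpM2l //; apply: le_trans (ler_normD _ _).
by rewrite le_eqVlt; apply/orP; left; apply/eqP; congr `|_|; ring.
Qed.

Lemma pot_left (Y : finType) (v y : Y -> R) (t : R) :
  (forall i, t <= y i) -> pot v y t = \sum_i v i * y i - (\sum_i v i) * t.
Proof.
move=> ty; rewrite /pot mulr_suml -sumrB; apply: eq_bigr => i _.
by rewrite ger0_norm ?subr_ge0 // mulrBr.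
Qed.

Lemma pot_right (Y : finType) (v y : Y -> R) (t : R) :
  (forall i, y i <= t) -> pot v y t = (\sum_i v i) * t - \sum_i v i * y i.
Proof.
move=> ty; rewrite /pot mulr_suml -sumrB; apply: eq_bigr => i _.
by rewrite ler0_norm ?subr_le0 // opprB mulrBr.
Qed.

(** The maximum of the potentials is convex and Lipschitz with constant the common mass, and at the
    outer nodes all potentials agree, so its node values are those of the potential of some [w] on
    the nodes. Between nodes the latter is affine, so domination at the nodes spreads everywhere. *)
Lemma cx_upper_bound (I : finType) (i0 : I) (Y : I -> finType) (v y : forall i, Y i -> R)
    (M : nat) (t : nat -> R) (W mu : R) :
  let N := M.+1 in
  (forall i c, 0 <= v i c) -> (forall i, \sum_c v i c = W) ->
  (forall i, \sum_c v i c * y i c = mu) ->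
  (forall i c, t 0%N <= y i c <= t N) ->
  (forall i, (i < N)%N -> t i < t i.+1) ->
  exists w : 'I_N.+1 -> R, [/\ forall z, 0 <= w z,
    forall i, cx_le (v i) (y i) w (fun z => t z)
    & forall z : 'I_N.+1, exists i, pot w (fun z => t z) (t z) = pot (v i) (y i) (t z)].
Proof.
move=> N v0 mass mean y_in tS.
pose p i s := pot (v i) (y i) s.
have p0 i : p i (t 0%N) = mu - W * t 0%N.
  by rewrite /p pot_left ?mean ?mass // => c; case/andP: (y_in i c).
have pN i : p i (t N) = W * t N - mu.
  by rewrite /p pot_right ?mean ?mass // => c; case/andP: (y_in i c).
pose best k := [arg max_(i > i0) p i (t k)]%O.
pose g k := p (best k) (t k).
have g_ge i k : p i (t k) <= g k.
  by rewrite /g /best; case: arg_maxP => // j _; apply.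
have t_le := increasing_upto_le tS.
have [||||w [w0 wW wmu wg]] := @interpolating_measure M t g W tS.
(* Convexity of the maximum: the potential that is best at the middle node is convex and lies below
   [g] at the two neighbours. *)
- move=> i iN; have t1 := tS i (ltnW iN); have t2 := tS i.+1 iN.
  have tt : t i <= t i.+1 <= t i.+2 by rewrite !ltW.
  have h : (t i.+2 - t i) * g i.+1 <=
      (t i.+2 - t i.+1) * p (best i.+1) (t i) + (t i.+1 - t i) * p (best i.+1) (t i.+2).
    exact: pot_convex.
  have d1 : 0 <= t i.+1 - t i by rewrite subr_ge0 ltW.
  have d2 : 0 <= t i.+2 - t i.+1 by rewrite subr_ge0 ltW.
  have := ler_wpM2l d2 (g_ge (best i.+1) i).
  have := ler_wpM2l d1 (g_ge (best i.+1) i.+2).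
  lra.
- have := pot_lip (y (best 0%N)) (t 0%N) (t 1%N) (v0 (best 0%N)).
  rewrite mass ger0_norm ?subr_ge0; last exact/ltW/tS.
  have := g_ge (best 0%N) 1%N; rewrite /g /p; lra.
- have := pot_lip (y (best N)) (t N) (t M) (v0 (best N)).
  rewrite mass distrC ger0_norm ?subr_ge0; last exact/ltW/tS.
  have := g_ge (best N) M; rewrite /g /p; lra.
- by rewrite /g p0 pN; ring.
have mean_w : \sum_z w z * t z = mu.
  move: wmu; rewrite /g p0 pN => h; apply: (mulfI (_ : 2 != 0 :> R)); first by rewrite pnatr_eq0.
  by rewrite h; ring.
have t_ge0 (z : 'I_N.+1) : t 0%N <= t z by apply: t_le; have := ltn_ord z; lia.
have t_leN (z : 'I_N.+1) : t z <= t N by apply: t_le; have := ltn_ord z; lia.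
exists w; split => // [i|z]; last by exists (best z); rewrite wg.
split; [by rewrite mass wW|by rewrite mean mean_w|move=> s].
(* Outside the nodes both potentials are affine and determined by mass and mean alone. *)
have [s0|s0] := leP s (t 0%N).
  rewrite !pot_left ?mean ?mass ?wW ?mean_w // => [z|c]; apply: le_trans s0 _ => //.
  by case/andP: (y_in i c).
have [sN|sN] := leP (t N) s.
  rewrite !pot_right ?mean ?mass ?wW ?mean_w // => [z|c]; apply: le_trans sN => //.
  by case/andP: (y_in i c).
have Pa : [pred z : 'I_N.+1 | t z <= s] ord0 by rewrite /= ltW.
have Pb : [pred z : 'I_N.+1 | s <= t z] ord_max by rewrite /= ltW.
case: (arg_maxP (fun z : 'I_N.+1 => t z) Pa) => a /= xa amax.
case: (arg_minP (fun z : 'I_N.+1 => t z) Pb) => b /= xb bmin.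
apply: (@pot_le_between _ _ _ w (fun z => t z) (v i) (y i) (t a) s (t b)) => //.
- move=> z _; have [/amax|/ltW/bmin] := leP (t z) s; by [left|right].
- by rewrite xa.
- by rewrite wg; exact: g_ge.
- by rewrite wg; exact: g_ge.
Qed.
End Sup.

(** * Payoffs and experiments *)

Lemma sum_Theta (R : nmodType) (F : Theta -> R) :
  \sum_(th : Theta) F th = F state1 + F state2.
Proof.
rewrite /Theta big_ord_recl big_ord_recl big_ord0 addr0 /=.
by congr (_ + F _); apply: val_inj.
Qed.

Lemma ThetaP (P : Theta -> Prop) : P state1 -> P state2 -> forall th, P th.
Proof.
move=> P1 P2 [[|[|//]] lt].
  by have -> : Ordinal lt = state1 by apply: val_inj.
by have -> : Ordinal lt = state2 by apply: val_inj.
Qed.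

Section Payoffs.
Variable R : realType.

Definition point_mass (A : finType) (a b : A) : R := (b == a)%:R.

Lemma isDist_point_mass (A : finType) (a : A) : isDist (point_mass a).
Proof.
split=> [b|]; first exact: ler0n.
under eq_bigr do rewrite -[point_mass _ _]mulr1.
by rewrite (sum_delta a (fun=> 1)).
Qed.

Lemma eu_point_mass (A : finType) (u : Theta -> A -> R) th (a : A) :
  eu u th (point_mass a) = u th a.
Proof. exact: sum_delta. Qed.

Definition mixture (A : finType) (a b : A) (lam : R) (c : A) : R :=
  (c == a)%:R * (1 - lam) + (c == b)%:R * lam.

Lemma isDist_mixture (A : finType) (a b : A) (lam : R) :
  0 <= lam -> lam <= 1 -> isDist (mixture a b lam).
Proof.
move=> lam0 lam1; split=> [c|].
  by rewrite addr_ge0 // mulr_ge0 ?ler0n // subr_ge0.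
by rewrite big_split /= (sum_delta _ (fun=> 1 - lam)) (sum_delta _ (fun=> lam)) subrK.
Qed.

Lemma eu_mixture (A : finType) (u : Theta -> A -> R) th (a b : A) (lam : R) :
  eu u th (mixture a b lam) = (1 - lam) * u th a + lam * u th b.
Proof.
rewrite /eu /mixture; under eq_bigr do rewrite mulrDl -!mulrA.
rewrite big_split /= (sum_delta _ (fun i => (1 - lam) * u th i)).
by rewrite (sum_delta _ (fun i => lam * u th i)).
Qed.

Lemma eu_bound (A : finType) (u : Theta -> A -> R) th (al : A -> R) :
  isDist al -> `|eu u th al| <= \sum_a `|u th a|.
Proof.
move=> [al0 al1]; apply: le_trans (ler_norm_sum _ _ _) _; apply: ler_sum => a _.
rewrite normrM ger0_norm // ler_piMl // -al1 (bigD1 a) //= lerDl.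
exact: sumr_ge0.
Qed.

Lemma payoff_bound (Yb A : finType) (u : Theta -> A -> R) (Q : Theta -> Yb -> R)
    (sigma : Yb -> A -> R) :
  (forall th, isDist (Q th)) -> isStrategy sigma ->
  `|payoff u Q sigma| <= \sum_th \sum_a `|u th a|.
Proof.
move=> Qd sd; apply: le_trans (ler_norm_sum _ _ _) _; apply: ler_sum => th _.
have [Q0 Q1] := Qd th; apply: le_trans (ler_norm_sum _ _ _) _.
rewrite -[leRHS]mul1r -Q1 mulr_suml; apply: ler_sum => y _.
by rewrite normrM (ger0_norm (Q0 y)) ler_wpM2l // eu_bound.
Qed.

Lemma payoff_le_Vsingle (Y A : finType) (P : Theta -> Y -> R) (u : Theta -> A -> R)
    (sigma : Y -> A -> R) :
  isExperiment P -> isStrategy sigma -> payoff u P sigma <= Vsingle P u.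
Proof.
move=> Pe sd; apply: ub_le_sup; last by exists sigma.
exists (\sum_th \sum_a `|u th a|) => _ [s [sds ->]].
exact: le_trans (ler_norm _) (payoff_bound _ Pe sds).
Qed.

Lemma worst_le_payoff (m : nat) (Y : 'I_m -> finType)
    (P : forall j : 'I_m, Theta -> Y j -> R)
    (A : finType) (u : Theta -> A -> R) (sigma : jointY Y -> A -> R) Q :
  isStrategy sigma -> isCoupling P Q -> worst P u sigma <= payoff u Q sigma.
Proof.
move=> sd Qc; apply: ge_inf; last by exists Q.
exists (- \sum_th \sum_a `|u th a|) => _ [Q' [[Qd _] ->]].
by rewrite lerNl; apply: le_trans (payoff_bound u Qd sd); rewrite -normrN ler_norm.
Qed.

Lemma le_worst (m : nat) (Y : 'I_m -> finType)
    (P : forall j : 'I_m, Theta -> Y j -> R)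
    (A : finType) (u : Theta -> A -> R) (sigma : jointY Y -> A -> R) Q0 r :
  isCoupling P Q0 -> (forall Q, isCoupling P Q -> r <= payoff u Q sigma) ->
  r <= worst P u sigma.
Proof.
move=> Q0c h; apply: lb_le_inf; first by exists (payoff u Q0 sigma), Q0.
by move=> _ [Q [Qc ->]]; exact: h.
Qed.

(** The payoff under [Q0] bounds all worst cases uniformly, so the set under the supremum is bounded
    above. *)
Lemma worst_le_Vrob (m : nat) (Y : 'I_m -> finType)
    (P : forall j : 'I_m, Theta -> Y j -> R)
    (A : finType) (u : Theta -> A -> R) (sigma : jointY Y -> A -> R) Q0 :
  isCoupling P Q0 -> isStrategy sigma -> worst P u sigma <= Vrob P u.
Proof.
move=> Qc sd; apply: ub_le_sup; last by exists sigma.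
exists (\sum_th \sum_a `|u th a|) => _ [s [sds ->]].
apply: le_trans (worst_le_payoff u sds Qc) _; case: Qc => Qd _.
exact: le_trans (ler_norm _) (payoff_bound _ Qd sds).
Qed.

(** The action [a0] provides a strategy, so that [sup] is taken over a nonempty set. *)
Lemma Vrob_le (m : nat) (Y : 'I_m -> finType)
    (P : forall j : 'I_m, Theta -> Y j -> R)
    (A : finType) (a0 : A) (u : Theta -> A -> R) Q r :
  isCoupling P Q -> (forall sigma, isStrategy sigma -> payoff u Q sigma <= r) ->
  Vrob P u <= r.
Proof.
move=> Qc h; apply: ge_sup.
  exists (worst P u (fun=> point_mass a0)), (fun=> point_mass a0); split => // y.
  exact: isDist_point_mass.
move=> _ [s [sds ->]]; apply: le_trans (worst_le_payoff u sds Qc) (h _ sds).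
Qed.

(** A strategy reading signal [j] alone sees only the [j]-th marginal, which all couplings share. *)
Lemma payoff_lift (m : nat) (Y : 'I_m -> finType)
    (P : forall j : 'I_m, Theta -> Y j -> R)
    (A : finType) (u : Theta -> A -> R) (j : 'I_m) (s : Y j -> A -> R) Q :
  isCoupling P Q -> payoff u Q (fun yy => s (yy j)) = payoff u (P j) s.
Proof.
move=> [_ Qm]; apply: eq_bigr => th _.
rewrite (partition_big (fun yy : jointY Y => yy j) predT) //=; apply: eq_bigr => y _.
rewrite -(Qm th j y) mulr_suml; apply: eq_bigr => yy /eqP ->; by [].
Qed.

(** Ignoring every signal but the [j]-th guarantees the same payoff under all couplings. *)
Lemma Vsingle_le_Vrob (m : nat) (Y : 'I_m -> finType)
    (P : forall j : 'I_m, Theta -> Y j -> R)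
    (A : finType) (a0 : A) (u : Theta -> A -> R) (j : 'I_m) Q0 :
  isCoupling P Q0 -> Vsingle (P j) u <= Vrob P u.
Proof.
move=> Qc; apply: ge_sup.
  exists (payoff u (P j) (fun=> point_mass a0)), (fun=> point_mass a0); split => // y.
  exact: isDist_point_mass.
move=> _ [s [sds ->]].
have sd' : isStrategy (fun yy : jointY Y => s (yy j)) by move=> yy; exact: sds.
apply: le_trans (worst_le_Vrob u Qc sd').
by apply: (le_worst Qc) => Q /(payoff_lift u s) ->.
Qed.

End Payoffs.

Arguments point_mass {R A} a b.

(** * Experiments as measures of posteriors *)

Section Experiments.
Variable R : realType.

(* An experiment is encoded by the distribution of the posterior probability of [state1]
   under the weights (1, 1) on the states, so the total mass is 2; a signal of mass 0 gets
   the junk posterior 0. *)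
Definition mass (Y : finType) (P : Theta -> Y -> R) (y : Y) : R := P state1 y + P state2 y.
Definition posterior (Y : finType) (P : Theta -> Y -> R) (y : Y) : R :=
  P state1 y / mass P y.

Definition prob_of (x : R) (th : Theta) : R := if th == state1 then x else 1 - x.

Lemma mass_ge0 (Y : finType) (P : Theta -> Y -> R) y : isExperiment P -> 0 <= mass P y.
Proof. by move=> Pe; apply: addr_ge0; case: (Pe state1) (Pe state2) => ? _ [? _]. Qed.

(** The junk posterior is harmless: a signal of mass 0 has probability 0 in both states. *)
Lemma mass_prob (Y : finType) (P : Theta -> Y -> R) th y : isExperiment P ->
  mass P y * prob_of (posterior P y) th = P th y.
Proof.
move=> Pe; have [P10 _] := Pe state1; have [P20 _] := Pe state2.
have e1 : mass P y * posterior P y = P state1 y.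
  rewrite /posterior mulrC; have [m0|m0] := eqVneq (mass P y) 0; last by rewrite divfK.
  rewrite m0 mulr0; move/eqP: m0.
  by rewrite /mass paddr_eq0 // => /andP[/eqP -> _].
move: th; apply: ThetaP; rewrite /prob_of /=; first by [].
by rewrite mulrBr mulr1 e1 /mass; ring.
Qed.

Lemma posterior_itv (Y : finType) (P : Theta -> Y -> R) y : isExperiment P ->
  0 <= posterior P y <= 1.
Proof.
move=> Pe; have [P10 _] := Pe state1; have [P20 _] := Pe state2.
have := mass_ge0 y Pe; rewrite le_eqVlt => /orP[/eqP m0|m0].
  by rewrite /posterior -m0 invr0 mulr0 lexx ler01.
by rewrite /posterior divr_ge0 ?(ltW m0) ?P10 //= ler_pdivrMr // mul1r /mass lerDl.
Qed.

Lemma mass_total (Y : finType) (P : Theta -> Y -> R) : isExperiment P ->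
  \sum_y mass P y = 2.
Proof. by move=> Pe; rewrite big_split /=; case: (Pe state1) (Pe state2) => _ -> [_ ->]. Qed.

Lemma mass_mean (Y : finType) (P : Theta -> Y -> R) : isExperiment P ->
  \sum_y mass P y * posterior P y = 1.
Proof.
move=> Pe; rewrite -(Pe state1).2; apply: eq_bigr => y _.
exact: (mass_prob state1 y Pe).
Qed.

(** The endpoints 0 and 1 are added so that the nodes enclose every posterior; they shift threshold
    [l] to index [l.+1]. *)
Definition threshold_nodes (n : nat) (tau : 'I_n -> R) (i : nat) : R :=
  if i is i'.+1 then if insub i' is Some l then tau l else 1 else 0.

Lemma threshold_nodesS (n : nat) (tau : 'I_n -> R) (l : 'I_n) :
  threshold_nodes tau l.+1 = tau l.
Proof. by rewrite /threshold_nodes valK. Qed.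

Lemma threshold_nodes_last (n : nat) (tau : 'I_n -> R) : threshold_nodes tau n.+1 = 1.
Proof. by rewrite /threshold_nodes insubF // ltnn. Qed.

Lemma threshold_nodes_itv (n : nat) (tau : 'I_n -> R) (i : nat) :
  (forall l, 0 < tau l < 1) -> 0 <= threshold_nodes tau i <= 1.
Proof.
move=> tau01; case: i => [|i] /=; first by rewrite lexx ler01.
case: insubP => [l _ _|_]; last by rewrite lexx ler01.
by case/andP: (tau01 l) => ? ?; rewrite !ltW.
Qed.

Lemma threshold_nodes_lt (n : nat) (tau : 'I_n -> R) (i : nat) :
  (forall l, 0 < tau l < 1) ->
  (forall l l' : 'I_n, l' = l.+1 :> nat -> tau l < tau l') ->
  (i < n.+1)%N -> threshold_nodes tau i < threshold_nodes tau i.+1.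
Proof.
move=> tau01 tauS; case: i => [_|i] /=.
  by case: insubP => [l _ _|_]; [case/andP: (tau01 l)|exact: ltr01].
rewrite ltnS => iN; rewrite insubT /=; case: insubP => [l _ el|_].
  exact: tauS.
by case/andP: (tau01 (Sub i iN)).
Qed.

(* [w] on the points [x] is the interpolating upper bound of the experiments, and [K] makes
   the signals conditionally independent given its outcome. *)
Lemma exists_minimal_coupling (m : nat) (Y : 'I_m -> finType)
    (P : forall j : 'I_m, Theta -> Y j -> R) (n : nat) (tau : 'I_n -> R) :
  (0 < m)%N -> (forall j, isExperiment (P j)) ->
  (forall l, 0 < tau l < 1) ->
  (forall l l' : 'I_n, l' = l.+1 :> nat -> tau l < tau l') ->
  exists (Z : finType) (w x : Z -> R) (K : Z -> jointY Y -> R),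
  [/\ [/\ forall z, 0 <= w z, forall z yy, 0 <= K z yy &
      forall z, w z != 0 -> \sum_yy K z yy = 1],
    isCoupling P (fun th yy => \sum_z w z * prob_of (x z) th * K z yy),
    \sum_z w z = 2, \sum_z w z * x z = 1
  & forall l, exists j, pot w x (tau l) = pot (mass (P j)) (posterior (P j)) (tau l)].
Proof.
move=> m_gt0 Pe tau01 tauS.
pose t := threshold_nodes tau.
have [|||||w [w0 dom att]] := @cx_upper_bound R 'I_m (Ordinal m_gt0) Y
    (fun j => mass (P j)) (fun j => posterior (P j)) n t 2 1.
- by move=> j c; exact: mass_ge0.
- by move=> j; exact: mass_total.
- by move=> j; exact: mass_mean.
- by move=> j c; rewrite /t threshold_nodes_last; exact: posterior_itv.
- by move=> i; exact: threshold_nodes_lt.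
pose x (z : 'I_n.+2) := t z.
have x01 z : 0 <= x z <= 1 by exact: threshold_nodes_itv.
have kk j := cid (strassen w0 (fun y => mass_ge0 y (Pe j)) (dom j)).
pose k j := projT1 (kk j).
have k0 j z y : 0 <= k j z y by have [h _ _ _] := projT2 (kk j); exact: h.
have kw j z : \sum_y k j z y = w z by have [_ h _ _] := projT2 (kk j); exact: h.
have km j y : \sum_z k j z y = mass (P j) y by have [_ _ h _] := projT2 (kk j); exact: h.
have kx j y : \sum_z k j z y * x z = mass (P j) y * posterior (P j) y.
  by have [_ _ _ h] := projT2 (kk j); exact: h.
have prob0 z th : 0 <= prob_of (x z) th.
  by rewrite /prob_of; case: ifP => _; case/andP: (x01 z); rewrite ?subr_ge0.
have w2 : \sum_z w z = 2.
  by case: (dom (Ordinal m_gt0)) => <- _ _; exact: mass_total.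
have wx : \sum_z w z * x z = 1.
  by case: (dom (Ordinal m_gt0)) => _ <- _; exact: mass_mean.
(* Dividing the plan by [w z] gives the law of signal [j] given [z]; where [w z] is 0 the quotients
   vanish and are no distribution, hence the guards [w z != 0]. *)
pose K z (yy : jointY Y) := \prod_j (k j z (yy j) / w z).
have K0 z yy : 0 <= K z yy by apply: prodr_ge0 => j _; rewrite divr_ge0.
have k1 j z : w z != 0 -> \sum_y k j z y / w z = 1.
  by move=> wz; rewrite -mulr_suml kw divff.
have K1 z : w z != 0 -> \sum_yy K z yy = 1.
  move=> wz; rewrite (sum_prod_dffun (fun j y => k j z y / w z)) big1 // => j _.
  exact: k1.
exists 'I_n.+2, w, x, K; split => //; last first.
  move=> l; have [j] := att (inord l.+1).
  by rewrite /t inordK ?threshold_nodesS; [exists j|rewrite !ltnS ltnW].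
split=> [th|th j y].
  split=> [yy|]; first by apply: sumr_ge0 => z _; rewrite !mulr_ge0.
  rewrite exchange_big /=; transitivity (\sum_z w z * prob_of (x z) th).
    apply: eq_bigr => z _; rewrite -mulr_sumr.
    by have [->|/K1 ->] := eqVneq (w z) 0; rewrite ?mul0r ?mulr1.
  move: th; apply: ThetaP; rewrite /prob_of /= ?wx //.
  by under eq_bigr do rewrite mulrBr mulr1; rewrite sumrB w2 wx; lra.
(* Summing out the other signals leaves the plan [k j], whose mass and barycentre conditions return
   [P j] in both states. *)
rewrite exchange_big /=; transitivity (\sum_z k j z y * prob_of (x z) th).
  apply: eq_bigr => z _; rewrite -mulr_sumr.
  have [wz|wz] := eqVneq (w z) 0.
    have -> : k j z y = 0; last by rewrite wz !mul0r.
    apply/eqP; have /eqP := kw j z; rewrite wz psumr_eq0 // => /allP.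
    by apply; exact: mem_index_enum.
  rewrite (sum_prod_dffun_marginal (F := fun j y => k j z y / w z)); last first.
    by move=> i _; exact: k1.
  by field.
rewrite -(mass_prob th y (Pe j)); move: th; apply: ThetaP; rewrite /prob_of /= ?kx //.
by under eq_bigr do rewrite mulrBr mulr1; rewrite sumrB km kx mulrBr mulr1.
Qed.
End Experiments.

(** * Decision problems with ordered actions *)

Section Binary.
Variable R : realType.

Lemma eu_canon (n : nat) (u : Theta -> 'I_n.+1 -> R) l th (al : bool -> R) :
  eu (canon_u u l) th al = al true * canon_u u l th true.
Proof. by rewrite /eu big_bool /= mulr0 addr0. Qed.

(** The probability of [state1] at which the expected gain [d] is 0. *)
Definition cutoff (d : Theta -> R) : R := - d state2 / (d state1 - d state2).

Lemma cutoffE (d : Theta -> R) (x : R) : 0 < d state1 -> d state2 < 0 ->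
  x * d state1 + (1 - x) * d state2 = (d state1 - d state2) * (x - cutoff d).
Proof. by move=> d1 d2; rewrite /cutoff; field; lra. Qed.

Lemma cutoff_itv (d : Theta -> R) : 0 < d state1 -> d state2 < 0 -> 0 < cutoff d < 1.
Proof.
move=> d1 d2; have e0 : 0 < d state1 - d state2 by lra.
by rewrite divr_gt0 ?oppr_gt0 //= ltr_pdivrMr // mul1r; lra.
Qed.

(** Obtained from [max 0 r = (|r| + r) / 2] with [r] the expected gain at a posterior: the absolute
    values sum to the potential at the cutoff, and total mass 2 with mean 1 gives the constant. *)
Definition binary_value (d : Theta -> R) (Z : finType) (w x : Z -> R) : R :=
  (d state1 - d state2) / 2 * (pot w x (cutoff d) + (1 - 2 * cutoff d)).

Lemma binary_valueE (d : Theta -> R) (Z : finType) (w x : Z -> R) :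
  0 < d state1 -> d state2 < 0 -> \sum_z w z = 2 -> \sum_z w z * x z = 1 ->
  binary_value d w x =
  \sum_z w z * Num.max 0 (x z * d state1 + (1 - x z) * d state2).
Proof.
move=> d1 d2 w2 wx; have e0 : 0 < d state1 - d state2 by lra.
rewrite /binary_value; have -> : 1 - 2 * cutoff d = \sum_z w z * (x z - cutoff d).
  by under eq_bigr do rewrite mulrBr; rewrite sumrB -mulr_suml w2 wx.
rewrite /pot -big_split mulr_sumr /=; apply: eq_bigr => z _.
rewrite cutoffE // -[0 in RHS](mulr0 (d state1 - d state2)) -maxr_pMr ?ltW //.
rewrite -mulrDr; case: leP => h.
  by rewrite ger0_norm //; field.
by rewrite ler0_norm ?ltW //; ring.
Qed.

Lemma binary_value_le_Vsingle (Y : finType) (P : Theta -> Y -> R) (u : Theta -> bool -> R) :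
  isExperiment P -> 0 < u state1 true -> u state2 true < 0 -> (forall th, u th false = 0) ->
  binary_value (fun th => u th true) (mass P) (posterior P) <= Vsingle P u.
Proof.
move=> Pe d1 d2 uf; rewrite binary_valueE ?mass_total ?mass_mean //.
pose c y := posterior P y * u state1 true + (1 - posterior P y) * u state2 true.
(* The boolean serves as the action: 1 exactly when the posterior expected gain is nonnegative. *)
pose s y := @point_mass R _ (0 <= c y).
have sd : isStrategy s by move=> y; exact: isDist_point_mass.
apply: le_trans (payoff_le_Vsingle u Pe sd).
rewrite le_eqVlt; apply/orP; left; apply/eqP.
rewrite /payoff sum_Theta -big_split; apply: eq_bigr => y _ /=.
rewrite !eu_point_mass -!(mass_prob _ y Pe) /prob_of /= -/(c y).
by case: leP => h; rewrite ?uf; [rewrite /c; ring|rewrite !mulr0 addr0].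
Qed.

(** Makes the default 0 of [\big[Num.max/0]] harmless. *)
Lemma Vsingle_ge0 (Y : finType) (P : Theta -> Y -> R) (u : Theta -> bool -> R) :
  isExperiment P -> (forall th, u th false = 0) -> 0 <= Vsingle P u.
Proof.
move=> Pe uf; pose s (_ : Y) := @point_mass R _ false.
have sd : isStrategy s by move=> y; exact: isDist_point_mass.
apply: le_trans (payoff_le_Vsingle u Pe sd).
rewrite /payoff big1 // => th _; rewrite big1 // => y _.
by rewrite eu_point_mass uf mulr0.
Qed.
End Binary.

Section Chain.
Variables (R : realType) (n : nat) (u : Theta -> 'I_n.+1 -> R).
Hypothesis u0 : forall th, u th ord0 = 0.
Let d (l : 'I_n) th := canon_u u l th true.

Lemma telescope_canon th (k : 'I_n.+1) :
  u th k = \sum_(l < n | (l < k)%N) d l th.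
Proof.
case: k => k; elim: k => [|k IH] kn.
  rewrite big_pred0 //=; first by rewrite -(u0 th); congr (u _ _); apply: val_inj.
have kn0 : (k < n)%N by [].
have kn' : (k < n.+1)%N by rewrite ltnW.
rewrite (bigD1 (Ordinal kn0)) //= (eq_bigl (fun l : 'I_n => (l < k)%N)); last first.
  by move=> l; rewrite -val_eqE /= ltnS (ltn_neqAle l) andbC.
rewrite -(IH kn') /d /canon_u.
have -> : lift ord0 (Ordinal kn0) = Ordinal kn by apply: val_inj.
have -> : widen_ord (leqnSn n) (Ordinal kn0) = Ordinal kn' by apply: val_inj.
by rewrite subrK.
Qed.

Hypothesis d1 : forall l, 0 < d l state1.
Hypothesis d2 : forall l, d l state2 < 0.

(** Given [z], the signal carries no further information on the state. Action [k] then earns the sum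
    of the first [k] expected increments, at most the sum of the positive parts of all of them,
    which is what the binary problems earn at [z]. *)
Lemma garbling_payoff_le (Yb Z : finType) (w x : Z -> R) (K : Z -> Yb -> R)
    (sigma : Yb -> 'I_n.+1 -> R) :
  (forall z, 0 <= w z) -> (forall z y, 0 <= K z y) ->
  (forall z, w z != 0 -> \sum_y K z y = 1) ->
  \sum_z w z = 2 -> \sum_z w z * x z = 1 -> isStrategy sigma ->
  payoff u (fun th y => \sum_z w z * prob_of (x z) th * K z y) sigma <=
  \sum_l binary_value (d l) w x.
Proof.
move=> w0 K0 K1 w2 wx sd.
pose B z := \sum_l w z * Num.max 0 (x z * d l state1 + (1 - x z) * d l state2).
have -> : \sum_l binary_value (d l) w x = \sum_z B z.
  rewrite exchange_big; apply: eq_bigr => l _; exact: binary_valueE.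
have -> : \sum_z B z = \sum_z \sum_y K z y * B z.
  apply: eq_bigr => z _; rewrite -mulr_suml.
  have [wz|/K1 ->] := eqVneq (w z) 0; last by rewrite mul1r.
  by rewrite /B big1 ?mulr0 // => l _; rewrite wz mul0r.
have -> : payoff u (fun th y => \sum_z w z * prob_of (x z) th * K z y) sigma =
    \sum_z \sum_y K z y * \sum_k sigma y k * (w z * (x z * u state1 k + (1 - x z) * u state2 k)).
  rewrite /payoff exchange_big [RHS]exchange_big /=; apply: eq_bigr => y _.
  rewrite sum_Theta !mulr_suml -big_split; apply: eq_bigr => z _ /=.
  rewrite /eu !mulr_sumr -big_split; apply: eq_bigr => k _ /=.
  by rewrite /prob_of /=; ring.
apply: ler_sum => z _; apply: ler_sum => y _; apply: ler_wpM2l => //.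
have [s0 s1] := sd y.
rewrite -[leRHS]mul1r -[X in _ <= X * _]s1 mulr_suml.
apply: ler_sum => k _; apply: ler_wpM2l => //.
rewrite /B -mulr_sumr; apply: ler_wpM2l => //.
rewrite !telescope_canon !mulr_sumr -big_split /= big_mkcond /=.
by apply: ler_sum => l _; case: ifP => _; rewrite le_max lexx ?orbT.
Qed.

Hypothesis cutoff_le : forall l l' : 'I_n, (l <= l')%N -> cutoff (d l) <= cutoff (d l').

(** Rising cutoffs mean falling slopes [d l state2 / d l state1]: the chain of payoff vectors is
    concave. *)
Lemma slope_le (l l' : 'I_n) : (l <= l')%N ->
  d l state1 * d l' state2 <= d l state2 * d l' state1.
Proof.
move=> /cutoff_le; have := d1 l; have := d1 l'; have := d2 l; have := d2 l' => p1 p2 p3 p4.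
rewrite /cutoff ler_pdivrMr; last by lra.
rewrite mulrAC ler_pdivlMr; last by lra.
lra.
Qed.

(* Neyman-Pearson: among all selections from the increments with a given state-1 payoff,
   the one taking the steepest increments first is best in state 2, and it lies on the chain. *)
Lemma chain_dominates (s : 'I_n -> R) : (forall l, 0 <= s l <= 1) ->
  exists al : 'I_n.+1 -> R, isDist al /\ forall th, \sum_l s l * d l th <= eu u th al.
Proof.
move=> s01; have [n0|n_gt0] := posnP n.
  exists (point_mass ord0); split; first exact: isDist_point_mass.
  move=> th; rewrite eu_point_mass u0 big1 // => -[l ln].
  by exfalso; move: ln; rewrite n0.
set q := \sum_l s l * d l state1.
have q0 : 0 <= q.
  by apply: sumr_ge0 => l _; case/andP: (s01 l) => ? _; rewrite mulr_ge0 // ltW.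
pose up (l : 'I_n) := u state1 (lift ord0 l).
have lt_pred : (n.-1 < n)%N by rewrite ltn_predL.
have Pl : [pred l : 'I_n | q <= up l] (Ordinal lt_pred).
  rewrite /= /up telescope_canon [leRHS](eq_bigl predT) /=; last first.
    by move=> [l ln]; rewrite /bump /=; lia.
  by apply: ler_sum => l _; case/andP: (s01 l) => _ ?; rewrite ler_piMl // ltW.
(* [k] is the first increment whose upper end reaches [q]; minimality yields [kq], so [q] falls
   within this increment. *)
case: (arg_minnP (fun l : 'I_n => l : nat) Pl) => k /= qk kmin.
have kq : u state1 (widen_ord (leqnSn n) k) <= q.
  have [k0|k_gt0] := posnP k.
    by rewrite (_ : widen_ord (leqnSn n) k = ord0) ?u0 //; apply: val_inj.
  have kn : (k.-1 < n)%N by rewrite prednK // ltnW.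
  have -> : u state1 (widen_ord (leqnSn n) k) = up (Ordinal kn).
    by congr (u _ _); apply: val_inj; rewrite /= /bump add1n prednK.
  rewrite leNgt; apply/negP => /ltW /kmin /=.
  by rewrite leqNgt ltn_predL k_gt0.
have updk : up k = u state1 (widen_ord (leqnSn n) k) + d k state1.
  by rewrite /up /d /canon_u; ring.
have [lam [lam0 lam1 lamE]] : exists lam, [/\ 0 <= lam, lam <= 1
    & lam * d k state1 = q - u state1 (widen_ord (leqnSn n) k)].
  exists ((q - u state1 (widen_ord (leqnSn n) k)) / d k state1); split.
  - by apply: divr_ge0; [rewrite subr_ge0|exact: ltW].
  - by rewrite ler_pdivrMr // mul1r; lra.
  - by rewrite divfK ?lt0r_neq0.
pose al := mixture (widen_ord (leqnSn n) k) (lift ord0 k) lam.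
have euE th : eu u th al = u th (widen_ord (leqnSn n) k) + lam * d k th.
  by rewrite eu_mixture /d /canon_u; ring.
(* The greedy selection: whole increments before [k], the fraction [lam] of [k], nothing after. *)
pose s' (l : 'I_n) : R := if (l < k)%N then 1 else if l == k then lam else 0.
have euE' th : eu u th al = \sum_l s' l * d l th.
  have s'k : s' k = lam by rewrite /s' ltnn eqxx.
  rewrite euE telescope_canon [RHS](bigD1 k) //= s'k [RHS]addrC; congr (_ + _).
  rewrite big_mkcond [RHS]big_mkcond /=; apply: eq_bigr => l _.
  rewrite /s'; have [->|lk] := eqVneq l k; first by rewrite ltnn.
  by case: ifP; rewrite ?mul1r ?mul0r.
exists al; split; first exact: isDist_mixture.
have eq1 : \sum_l s' l * d l state1 = q.
  by rewrite -euE' euE lamE; ring.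
apply: ThetaP; first by rewrite euE' eq1.
rewrite euE' -subr_ge0 -(pmulr_rge0 _ (d1 k)) -sumrB mulr_sumr.
(* Both selections agree in state 1, so this weighted difference can be subtracted freely. What
   remains is, term by term, [s' l - s l] times a slope comparison with [k], and both factors change
   sign at [k]. *)
have crossed : \sum_l (s' l - s l) * d l state1 * d k state2 = 0.
  by rewrite -mulr_suml; under eq_bigr do rewrite mulrBl; rewrite sumrB eq1 subrr mul0r.
rewrite -[leLHS]crossed; apply: ler_sum => l _; case/andP: (s01 l) => sl0 sl1.
rewrite -mulrBl mulrCA -mulrA.
rewrite -subr_ge0 -mulrBr /s'; case: ltngtP => lk.
- by apply: mulr_ge0; [lra|have := slope_le (ltnW lk); lra].
- have -> : (l == k) = false by apply/negbTE; rewrite -val_eqE /= gtn_eqF.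
  by apply: mulr_le0; [lra|have := slope_le (ltnW lk); lra].
- have -> : l = k by apply: val_inj.
  by rewrite [X in _ * X](_ : _ = 0) ?mulr0 //; ring.
Qed.
End Chain.

(** If the cutoff failed to rise from [l] to [l'], the action shared by the two increments would lie
    on or below the chord joining its neighbours. The mixture of these neighbours with the same
    state-1 payoff, which is how [lam] is chosen, would then weakly dominate it. *)
Lemma undominated_cutoff_lt (R : realType) (n : nat) (u : Theta -> 'I_n.+1 -> R) :
  let d l th := canon_u u l th true in
  (forall l, 0 < d l state1) -> (forall l, d l state2 < 0) ->
  (forall i : 'I_n.+1, ~ exists alpha : 'I_n.+1 -> R,
       isDist alpha /\ alpha i = 0 /\ forall th, u th i <= eu u th alpha) ->
  forall l l' : 'I_n, l' = l.+1 :> nat -> cutoff (d l) < cutoff (d l').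
Proof.
move=> d d1 d2 undom l l' ll'; rewrite ltNge; apply/negP => le_cut.
have p1 := d1 l; have p2 := d1 l'; have p3 := d2 l; have p4 := d2 l'.
have slope : d l state2 * d l' state1 <= d l' state2 * d l state1.
  move: le_cut; rewrite /cutoff ler_pdivrMr; last by lra.
  rewrite mulrAC ler_pdivlMr; last by lra.
  lra.
have mid : lift ord0 l = widen_ord (leqnSn n) l' by apply: val_inj; rewrite /= ll'.
have e0 : 0 < d l state1 + d l' state1 by rewrite addr_gt0.
have [lam [lam0 lam1 lamE]] : exists lam, [/\ 0 <= lam, lam <= 1
    & lam * (d l state1 + d l' state1) = d l state1].
  exists (d l state1 / (d l state1 + d l' state1)); split.
  - by rewrite divr_ge0 ?ltW.
  - by rewrite ler_pdivrMr // mul1r lerDl ltW.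
  - by rewrite divfK ?lt0r_neq0.
apply: (undom (lift ord0 l)).
exists (mixture (widen_ord (leqnSn n) l) (lift ord0 l') lam).
split; first exact: isDist_mixture.
split.
  rewrite /mixture -!val_eqE /= /bump /= !add1n ll' [l.+1 == l]gtn_eqF //.
  by rewrite ltn_eqF // !mul0r addr0.
have euE th : eu u th (mixture (widen_ord (leqnSn n) l) (lift ord0 l') lam) =
    u th (widen_ord (leqnSn n) l) + lam * (d l th + d l' th).
  by rewrite eu_mixture /d /canon_u -mid; ring.
apply: ThetaP; rewrite euE.
  by rewrite lamE /d /canon_u; lra.
suff : d l state2 <= lam * (d l state2 + d l' state2) by rewrite {1}/d /canon_u; lra.
rewrite -(ler_pM2r e0) mulrAC lamE; lra.
Qed.

Lemma adjacent_lt_le (R : realType) (n : nat) (f : 'I_n -> R) :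
  (forall l l' : 'I_n, l' = l.+1 :> nat -> f l < f l') ->
  forall l l' : 'I_n, (l <= l')%N -> f l <= f l'.
Proof.
move=> fS l [k kn]; elim: k kn => [|k IH] kn /=.
  rewrite leqn0 => /eqP l0; have -> : l = Ordinal kn by apply: val_inj.
  by [].
rewrite leq_eqVlt => /orP[/eqP lk|lk].
  by have -> : l = Ordinal kn by apply: val_inj.
have kn' := ltnW kn; apply: le_trans (IH kn' lk) _.
by apply/ltW/fS.
Qed.

Theorem theorem2 (R : realType) (m : nat) (Y : 'I_m -> finType)
  (P : forall j : 'I_m, Theta -> Y j -> R) (n : nat) (u : Theta -> 'I_n.+1 -> R)
  (sigmas : 'I_n -> jointY Y -> bool -> R) :
  (0 < m)%N ->
  (forall j, isExperiment (P j)) ->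
  (forall i : 'I_n, u state1 (widen_ord (leqnSn n) i) < u state1 (lift ord0 i)) ->
  (forall i : 'I_n, u state2 (widen_ord (leqnSn n) i) > u state2 (lift ord0 i)) ->
  (forall th, u th ord0 = 0) ->
  (forall i : 'I_n.+1, ~ exists alpha : 'I_n.+1 -> R,
       isDist alpha /\ alpha i = 0 /\ forall th, u th i <= eu u th alpha) ->
  (forall l : 'I_n, robustly_optimal P (canon_u u l) (sigmas l)) ->
  Vrob P u = \sum_(l < n) \big[Num.max/0]_(j < m) Vsingle (P j) (canon_u u l)
  /\ (exists sigma : jointY Y -> 'I_n.+1 -> R, isStrategy sigma /\
        forall y th, eu u th (sigma y) >= \sum_(l < n) eu (canon_u u l) th (sigmas l y))
  /\ (forall sigma : jointY Y -> 'I_n.+1 -> R, isStrategy sigma ->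
        (forall y th, eu u th (sigma y) >= \sum_(l < n) eu (canon_u u l) th (sigmas l y)) ->
        robustly_optimal P u sigma).
Proof.
move=> m_gt0 Pe u1 u2 u0 undom opt.
pose d (l : 'I_n) th := canon_u u l th true.
have d1 l : 0 < d l state1 by rewrite subr_gt0.
have d2 l : d l state2 < 0 by rewrite subr_lt0.
have cut_lt := undominated_cutoff_lt d1 d2 undom.
have cut_le := adjacent_lt_le cut_lt.
have [Z [w [x [K [[w0 K0 K1] Qc w2 wx att]]]]] :=
  exists_minimal_coupling m_gt0 Pe (fun l => cutoff_itv (d1 l) (d2 l)) cut_lt.
set Q := fun th yy => _ in Qc.
pose M l := \big[Num.max/0]_(j < m) Vsingle (P j) (canon_u u l).
have VuM : Vrob P u <= \sum_l M l.
  apply: (Vrob_le ord0 Qc) => s sd.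
  apply: le_trans (garbling_payoff_le u0 d1 d2 w0 K0 K1 w2 wx sd) _.
  apply: ler_sum => l _; have [j hj] := att l.
  apply: le_trans (le_bigmax _ _ j).
  (* A binary value depends on the measure only through its potential at the cutoff, where [w]
     agrees with some [P j]. *)
  rewrite /binary_value hj -/(binary_value _ _ _).
  exact: (binary_value_le_Vsingle (Pe j) (d1 l) (d2 l) (fun=> erefl)).
have MV l : M l <= Vrob P (canon_u u l).
  apply: bigmax_le => [|j _]; last exact: (Vsingle_le_Vrob false _ _ Qc).
  apply: le_trans (Vsingle_le_Vrob false _ (Ordinal m_gt0) Qc).
  exact: Vsingle_ge0.
have optimal s : isStrategy s ->
    (forall y th, eu u th (s y) >= \sum_(l < n) eu (canon_u u l) th (sigmas l y)) ->
    \sum_l M l <= worst P u s.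
  move=> sd s_ge; apply: (le_worst Qc) => Q' Q'c.
  (* Under any one coupling each [sigmas l] earns at least its own worst case, and [s] does at least
     as well as their sum signal by signal. *)
  apply: (@le_trans _ _ (\sum_l payoff (canon_u u l) Q' (sigmas l))).
    apply: ler_sum => l _; apply: le_trans (MV l) _.
    by have [sdl <-] := opt l; exact: worst_le_payoff.
  rewrite /payoff exchange_big; apply: ler_sum => th _ /=.
  rewrite exchange_big; apply: ler_sum => yy _ /=.
  by rewrite -mulr_sumr; apply: ler_wpM2l => //; case: Q'c => /(_ th) [].
have [s [sd s_ge]] : exists sigma : jointY Y -> 'I_n.+1 -> R, isStrategy sigma /\
    forall y th, eu u th (sigma y) >= \sum_(l < n) eu (canon_u u l) th (sigmas l y).
  (* The probabilities of action 1 select fractions of the increments, as [chain_dominates]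
     expects. *)
  have s01 yy l : 0 <= sigmas l yy true <= 1.
    have [/(_ yy) [s0 s1] _] := opt l; rewrite s0 /= -s1 big_bool lerDl.
    exact: s0.
  have al yy := cid (chain_dominates u0 d1 d2 cut_le (s01 yy)).
  exists (fun yy => projT1 (al yy)); split=> [yy|yy th].
    by have [] := projT2 (al yy).
  have [_ h] := projT2 (al yy); apply: le_trans (h th).
  by apply: ler_sum => l _; rewrite eu_canon.
have VE : Vrob P u = \sum_l M l.
  apply/eqP; rewrite eq_le VuM; apply: le_trans (optimal s sd s_ge) _.
  exact: worst_le_Vrob Qc sd.
split; [exact: VE|split; first by exists s].
move=> s' sd' s'_ge; split => //; apply/eqP; rewrite eq_le.
rewrite (worst_le_Vrob u Qc sd') VE; exact: optimal.
Qed.
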